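(* Let $H_1$ and $H_2$ be $n$-Hilbert spaces over $\mathbb{K}$, with $a_2,\dots,a_n\in H_1$ and $b_2,\dots,b_n\in H_2$ fixed and with associated Hilbert spaces $H_F$ and $K_G$, and let $K_1\in\mathcal{B}(H_F)$, $K_2\in\mathcal{B}(K_G)$. Let $\{f_i\}_{i=1}^\infty$ be an atomic system associated to $(a_2,\dots,a_n)$ for $K_1$ in $H_1$ and let $\{g_j\}_{j=1}^\infty$ be an atomic system associated to $(b_2,\dots,b_n)$ for $K_2$ in $H_2$. Then the sequence $\{f_i\otimes g_j\}_{i,j=1}^\infty$ is an atomic system associated to $(a_2\otimes b_2,\dots,a_n\otimes b_n)$ for $K_1\otimes K_2$ in $H_1\otimes H_2$.
   Context: Let $\mathbb{K}$ be $\mathbb{R}$ or $\mathbb{C}$. An $n$-inner product on a linear space $H$ over $\mathbb{K}$ with $\dim H\ge n$ is a map $(x,y,x_2,\dots,x_n)\mapsto\langle x,y\,|\,x_2,\dots,x_n\rangle\in\mathbb{K}$ that is linear in $x$, conjugate symmetric in $x,y$, invariant under permutations of $x_2,\dots,x_n$, and satisfies $\langle x_1,x_1\,|\,x_2,\dots,x_n\rangle\ge 0$ with equality iff $x_1,\dots,x_n$ are linearly dependent. Its $n$-norm is $\|x_1,\dots,x_n\|=\sqrt{\langle x_1,x_1\,|\,x_2,\dots,x_n\rangle}$. A sequence $\{x_k\}$ converges to $x$ if $\|x_k-x,x_2,\dots,x_n\|\to0$ for all $x_2,\dots,x_n\in H$, and is Cauchy if $\|x_l-x_k,x_2,\dots,x_n\|\to0$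 for all $x_2,\dots,x_n\in H$; $H$ is an $n$-Hilbert space if every Cauchy sequence converges. Let $a_2,\dots,a_n\in H_1$ be fixed and linearly independent, $F=\{a_2,\dots,a_n\}$, $L_F=\operatorname{span}F$. Then $\langle x+L_F,y+L_F\rangle_F=\langle x,y\,|\,a_2,\dots,a_n\rangle_1$ is an inner product on $H_1/L_F$; $H_F$ denotes its Hilbert space completion. Each $x\in H_1$ is identified with its class in $H_F$, and for $f,h\in H_F$ one writes $\langle f,h\,|\,a_2,\dots,a_n\rangle_1$ for $\langle f,h\rangle_F$ and $\|f,a_2,\dots,a_n\|_1$ for $\|f\|_F$. Similarly, with $b_2,\dots,b_n\in H_2$ fixed and linearly independent and $G=\{b_2,\dots,b_n\}$, $K_G$ is the Hilbert space obtained from $H_2$ and $\langle\cdot,\cdot\,|\,b_2,\dots,b_n\rangle_2$. $\mathcal{B}(X)$ is the space of bounded linear operators on $X$. A sequence $\{f_i\}\subseteq H_1$ is a Bessel sequence associated to $(a_2,\dots,a_n)$ in $H_1$ if for some $B>0$, $\sum_{i=1}^\infty|\langle f,f_i\,|\,a_2,\dots,a_n\rangle_1|^2\le B\|f,a_2,\dots,a_n\|_1^2$ for all $f\in H_1$. It is an atomic system associated to $(a_2,\dots,a_n)$ for $K_1\in\mathcal{B}(H_F)$ in $H_1$ if (I) it is a Bessel sequence associated to $(a_2,\dots,a_n)$ in $H_1$; and (II) there is $C>0$ such that for every $f\in H_F$ there is $\{c_i\}\in\ell^2(\mathbb{N})$ with $K_1f=\sum_{i=1}^\infty c_if_i$ (in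 $H_F$) and $\|\{c_i\}\|_{\ell^2}\le C\|f,a_2,\dots,a_n\|_1$. The definitions for $H_2$, $(b_2,\dots,b_n)$, $K_2\in\mathcal{B}(K_G)$ are analogous. $H_1\otimes H_2$ carries the $n$-inner product and $n$-norm given by $\langle f\otimes g,f'\otimes g'\,|\,f_2\otimes g_2,\dots,f_n\otimes g_n\rangle=\langle f,f'\,|\,f_2,\dots,f_n\rangle_1\langle g,g'\,|\,g_2,\dots,g_n\rangle_2$ and $\|f_1\otimes g_1,\dots,f_n\otimes g_n\|=\|f_1,\dots,f_n\|_1\|g_1,\dots,g_n\|_2$. $H_F\otimes K_G$ is the Hilbert space tensor product, and the same formulas are used for $f\in H_F$, $g\in K_G$ in the first slots and $a_i\otimes b_i$ in the remaining ones. $K_1\otimes K_2$ is the operator with $(K_1\otimes K_2)(f\otimes g)=K_1f\otimes K_2g$. $\{f_i\otimes g_j\}_{i,j}$ is a Bessel sequence associated to $(a_2\otimes b_2,\dots,a_n\otimes b_n)$ in $H_1\otimes H_2$ if for some $B>0$, $\sum_{i,j}|\langle f\otimes g,f_i\otimes g_j\,|\,a_2\otimes b_2,\dots,a_n\otimes b_n\rangle|^2\le B\|f\otimes g,a_2\otimes b_2,\dots,a_n\otimes b_n\|^2$ for all $f\otimes g\in H_F\otimes K_G$ ($f\in H_F$, $g\in K_G$). It is an atomic system associated to $(a_2\otimes b_2,\dots,a_n\otimes b_n)$ for $K_1\otimes K_2$ in $H_1\otimes H_2$ if it is such a Bessel sequence and there is $C>0$ such that for every $f\otimes g\in H_F\otimes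 K_G$ there are $c=\{c_i\},d=\{d_j\}\in\ell^2(\mathbb{N})$ such that, with $c\otimes d=\{c_id_j\}_{i,j}\in\ell^2(\mathbb{N}\times\mathbb{N})$, $(K_1\otimes K_2)(f\otimes g)=\sum_{i,j=1}^\infty c_id_j(f_i\otimes g_j)$ (in $H_F\otimes K_G$) and $\|c\otimes d\|_{\ell^2}\le C\|f\otimes g,a_2\otimes b_2,\dots,a_n\otimes b_n\|$. *)

(* Defs.v *)
From HB Require Import structures.
From mathcomp Require Import all_boot all_order all_algebra finmap.
From mathcomp Require Import all_classical all_reals all_analysis.
From mathcomp Require Import complex summability.
Set Implicit Arguments.
Unset Strict Implicit.
Unset Printing Implicit Defensive.
Import Order.TTheory GRing.Theory Num.Theory.
Import numFieldNormedType.Exports.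
Local Open Scope classical_set_scope.
Local Open Scope ring_scope.

Variant scalars := RealScalars | ComplexScalars.

Definition scalarField (R : realType) (k : scalars) : numFieldType :=
  match k with RealScalars => R | ComplexScalars => R[i] end.

Definition conjK (R : realType) (k : scalars) :
    scalarField R k -> scalarField R k :=
  match k with
  | RealScalars => fun x : R => x
  | ComplexScalars => fun z : R[i] => conjc z
  end.

Definition ReK (R : realType) (k : scalars) : scalarField R k -> R :=
  match k with
  | RealScalars => fun x : R => x
  | ComplexScalars => fun z : R[i] => complex.Re z
  end.

(* The norms of the library take their values in the scalar field (in the cone
   of nonnegative reals); [rnorm] is the same norm read in [R].  It applies to
   vectors and to scalars alike. *)
Definition rnorm (R : realType) (k : scalars)
    (V : normedZmodType (scalarField R k)) (x : V) : R := ReK `|x|.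

Section LinearAlgebra.
Variables (K : numFieldType) (V : lmodType K).

Definition lin_indep (s : seq V) : Prop :=
  forall c : 'I_(size s) -> K,
    \sum_(i < size s) c i *: s`_i = 0 -> forall i, c i = 0.

Definition lin_span (s : seq V) : set V :=
  [set x | exists c : 'I_(size s) -> K, x = \sum_(i < size s) c i *: s`_i].

End LinearAlgebra.

(* [nip x y [tuple x_2; ...; x_n]] is <x, y | x_2, ..., x_n>.  On complex
   scalars, [0 <= z] means that z is real and nonnegative. *)
Record nInnerSpace (R : realType) (k : scalars) (n : nat) := NInnerSpace {
  nspace :> lmodType (scalarField R k);
  nip : nspace -> nspace -> n.-1.-tuple nspace -> scalarField R k;
  nspace_dim : exists s : n.-tuple nspace, lin_indep s;
  nip_linear : forall (c : scalarField R k) x x' y xs,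
    nip (c *: x + x') y xs = c * nip x y xs + nip x' y xs;
  nip_conj : forall x y xs, nip x y xs = conjK (nip y x xs);
  nip_perm : forall x y (xs ys : n.-1.-tuple nspace),
    perm_eq xs ys -> nip x y xs = nip x y ys;
  nip_ge0 : forall x xs, 0 <= nip x x xs;
  nip_eq0 : forall x (xs : n.-1.-tuple nspace),
    nip x x xs = 0 <-> ~ lin_indep (x :: xs)
}.

Section NHilbert.
Variables (R : realType) (k : scalars) (n : nat) (H : nInnerSpace R k n).

Definition nnorm (x : H) (xs : n.-1.-tuple H) : R :=
  Num.sqrt (ReK (nip x x xs)).

Definition ncvg (u : nat -> H) (x : H) : Prop :=
  forall xs, nnorm (u m - x) xs @[m --> \oo] --> (0 : R).

Definition ncauchy (u : nat -> H) : Prop :=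
  forall xs, nnorm (u p.1 - u p.2) xs @[p --> (\oo, \oo)] --> (0 : R).

Definition is_nHilbert : Prop :=
  forall u, ncauchy u -> exists x, ncvg u x.

End NHilbert.

Record hilbertSpace (R : realType) (k : scalars) := HilbertSpace {
  hspace :> completeNormedModType (scalarField R k);
  inner : {dot hspace for @conjK R k};
  inner_norm : forall x : hspace, inner x x = `|x| ^+ 2
}.

Definition bounded_operator (R : realType) (k : scalars)
    (X : hilbertSpace R k) (T : {linear X -> X}) : Prop :=
  exists M : R, forall x, rnorm (T x) <= M * rnorm x.

(* A Hilbert space completion of H / span(a_2, ..., a_n): the class map
   followed by the inclusion into the completion is [to_compl].  It has kernel
   span(a_2, ..., a_n), so that H / span(a_2, ..., a_n) is identified with its
   range, on which the inner product is <x, y | a_2, ..., a_n>.  This fixes the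
   Hilbert space up to a unique isometric isomorphism under H. *)
Record assocHilbert (R : realType) (k : scalars) (n : nat)
    (H : nInnerSpace R k n) (a : n.-1.-tuple H) := AssocHilbert {
  compl :> hilbertSpace R k;
  to_compl : {linear H -> compl};
  to_compl_ker : forall x, to_compl x = 0 <-> lin_span a x;
  to_compl_inner : forall x y,
    inner compl (to_compl x) (to_compl y) = nip x y a;
  to_compl_dense : dense (range to_compl)
}.

(* The Hilbert tensor product, again up to a unique isometric isomorphism.
   When X and Y are associated with a_2, ..., a_n and b_2, ..., b_n, [inner] of
   this space is < . , . | a_2 (x) b_2, ..., a_n (x) b_n>. *)
Record hilbertTensor (R : realType) (k : scalars) (X Y : hilbertSpace R k) :=
  HilbertTensor {
  tspace :> hilbertSpace R k;
  tens : {bilinear X -> Y -> tspace};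
  tens_inner : forall f g f' g',
    inner tspace (tens f g) (tens f' g') = inner X f f' * inner Y g g';
  tens_dense : dense [set z : tspace |
    exists s : seq (X * Y), z = \sum_(p <- s) tens p.1 p.2]
}.

Definition is_tensor_operator (R : realType) (k : scalars)
    (X Y : hilbertSpace R k) (T : hilbertTensor X Y)
    (K1 : {linear X -> X}) (K2 : {linear Y -> Y}) (K12 : {linear T -> T}) :
    Prop :=
  bounded_operator K12 /\
  forall f g, K12 (tens T f g) = tens T (K1 f) (K2 g).

Definition l2norm (R : realType) (k : scalars) (I : choiceType)
    (c : I -> scalarField R k) : \bar R :=
  ((\esum_(i in [set: I]) (rnorm (c i) ^+ 2)%:E) `^ 2^-1)%E.

Section AtomicSystem.
Variables (R : realType) (k : scalars) (n : nat) (H : nInnerSpace R k n).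
Variables (a : n.-1.-tuple H) (HF : assocHilbert a).

Definition is_bessel (f_ : nat -> H) : Prop :=
  exists2 B : R, 0 < B &
    forall f : H,
      (\sum_(0 <= i <oo) (rnorm (nip f (f_ i) a) ^+ 2)%:E
         <= (B * nnorm f a ^+ 2)%:E)%E.

Definition is_atomic_system (K1 : {linear HF -> HF}) (f_ : nat -> H) : Prop :=
  is_bessel f_ /\
  exists2 C : R, 0 < C &
    forall f : HF, exists c : nat -> scalarField R k,
      [/\ (l2norm c < +oo)%E,
          series (fun i => c i *: to_compl HF (f_ i)) @ \oo --> K1 f &
          (l2norm c <= (C * rnorm f)%:E)%E].

End AtomicSystem.

(* Sums over N x N are unordered: [\esum] for nonnegative terms, and the limit
   along the finite subsets of N x N for vectors. *)
Section TensorAtomicSystem.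
Variables (R : realType) (k : scalars) (n : nat) (H1 H2 : nInnerSpace R k n).
Variables (a : n.-1.-tuple H1) (b : n.-1.-tuple H2).
Variables (HF : assocHilbert a) (KG : assocHilbert b) (T : hilbertTensor HF KG).

Definition tens_class (x : H1) (y : H2) : T :=
  tens T (to_compl HF x) (to_compl KG y).

Definition is_tensor_bessel (f_ : nat -> H1) (g_ : nat -> H2) : Prop :=
  exists2 B : R, 0 < B &
    forall (f : HF) (g : KG),
      (\esum_(p in [set: nat * nat])
          (rnorm (inner T (tens T f g) (tens_class (f_ p.1) (g_ p.2))) ^+ 2)%:E
         <= (B * rnorm (tens T f g) ^+ 2)%:E)%E.

Definition is_tensor_atomic_system (K12 : {linear T -> T})
    (f_ : nat -> H1) (g_ : nat -> H2) : Prop :=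
  is_tensor_bessel f_ g_ /\
  exists2 C : R, 0 < C &
    forall (f : HF) (g : KG), exists c d : nat -> scalarField R k,
      let cd (p : nat * nat) := c p.1 * d p.2 in
      [/\ (l2norm c < +oo)%E, (l2norm d < +oo)%E,
          partial_sum (fun p => cd p *: tens_class (f_ p.1) (g_ p.2))
            @ totally --> K12 (tens T f g) &
          (l2norm cd <= (C * rnorm (tens T f g))%:E)%E].

End TensorAtomicSystem.

(* Main.v *)
(* If sum_i |<f, f_i>|^2 <= B |f|^2, then |sum_i c_i f_i|^2 <= B sum_i |c_i|^2
   for finite sums, and conversely.  In this dual form the bounds B and B' of
   two sequences multiply: |sum_ij e_ij f_i (x) g_j|^2 <= B B' sum_ij |e_ij|^2.
   The converse, in the tensor product, is the Bessel inequality for f_i (x) g_j;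
   the bound itself shows that the finite sums of c_i d_j (f_i (x) g_j) over
   sets containing [0, N)^2 differ from the square sums, which converge to
   K1 f (x) K2 g, by at most the square root of B B' times a tail of
   sum_ij |c_i d_j|^2. *)
Require Import Defs.
From mathcomp Require Import all_boot all_order all_algebra finmap.
From mathcomp Require Import all_classical all_reals all_analysis.
From mathcomp Require Import complex summability ring lra.
Set Implicit Arguments.
Unset Strict Implicit.
Unset Printing Implicit Defensive.
Import Order.TTheory GRing.Theory Num.Theory.
Import numFieldNormedType.Exports.
Local Open Scope classical_set_scope.
Local Open Scope ring_scope.

(** * Real and complex scalars treated uniformly *)

Section Scalars.
Variables (R : realType) (k : scalars).
Notation K := (scalarField R k).
Implicit Types (z : K) (r : R).

(** A right inverse of [ReK], and a left inverse on nonnegative scalars; the two maps carry norm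
    identities between the scalar field and [R]. *)
Definition ofR r : K :=
  match k return scalarField R k with
  | RealScalars => r
  | ComplexScalars => r%:C%C
  end.

Lemma ReKD : {morph @ReK R k : z z' / z + z'}.
Proof. by rewrite /ReK; case: k => //= -[? ?] [? ?]. Qed.

Lemma ReK0 : ReK (0 : K) = 0.
Proof. by rewrite /ReK; case: k. Qed.

Lemma ReK_conj z : ReK (conjK z) = ReK z.
Proof. by rewrite /ReK /conjK; case: k z => //= -[]. Qed.

Lemma ReK_ofRM r z : ReK (ofR r * z) = r * ReK z.
Proof.
by rewrite /ReK /ofR; case: k z => //= -[? ?] /=; rewrite mul0r subr0.
Qed.

Lemma conj_ofR r : conjK (ofR r) = ofR r.
Proof. by rewrite /conjK /ofR; case: k => //=; rewrite oppr0. Qed.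

Lemma conjK0 : conjK (0 : K) = 0.
Proof. by rewrite /conjK; case: k => //=; rewrite oppr0. Qed.

Lemma ReK_ofR r : ReK (ofR r) = r.
Proof. by rewrite /ReK /ofR; case: k. Qed.

Lemma ofR0 : ofR 0 = 0.
Proof. by rewrite /ofR; case: k. Qed.

Lemma ltr_ofR r r' : (ofR r < ofR r') = (r < r').
Proof. by rewrite /ofR; case: k => //=; exact: ltcR. Qed.

Lemma ofR_ReK z : 0 <= z -> ofR (ReK z) = z.
Proof.
rewrite /ofR /ReK; case: k z => //= -[x y]; rewrite lecE /= => /andP[/eqP].
by move=> /= -> _.
Qed.

Lemma le_ReK z z' : z <= z' -> ReK z <= ReK z'.
Proof.
by rewrite /ReK; case: k z z' => //= -[? ?] [? ?]; rewrite lecE /= => /andP[].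
Qed.

Lemma norm_conjK z : `|conjK z| = `|z|.
Proof.
rewrite /conjK; case: k z => //= -[x y].
apply: etrans (normc_def (x -i* y)%C) _.
by apply: etrans (esym (normc_def (x +i* y)%C)); rewrite /= sqrrN.
Qed.

Lemma mul_conjK z : z * conjK z = `|z| ^+ 2.
Proof.
rewrite /conjK; case: k z => /= z; last exact: (esym (sqr_normc z)).
by rewrite -expr2 real_normK// num_real.
Qed.

Lemma ReK_le_norm z : ReK z <= ReK `|z|.
Proof.
rewrite /ReK; case: k z => /= [z|[x y]]; first exact: ler_norm.
apply: le_trans (ler_norm x) _.
by rewrite -sqrtr_sqr ler_wsqrtr// lerDl sqr_ge0.
Qed.

Lemma ReK_gt0 z : 0 < z -> 0 < ReK z.
Proof. by rewrite /ReK; case: k z => //= -[? ?]; rewrite ltcE /= => /andP[]. Qed.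

End Scalars.

(** * Real-valued norms and inner products *)

Section Norms.
Variables (R : realType) (k : scalars).
Notation K := (scalarField R k).

Lemma rnormE (V : normedModType K) (x : V) : ofR k (rnorm x) = `|x|.
Proof. exact: ofR_ReK. Qed.

Lemma rnorm_ge0 (V : normedModType K) (x : V) : 0 <= rnorm x.
Proof. by rewrite -(ReK0 R k); exact: le_ReK. Qed.

Lemma rnormD (V : normedModType K) (x y : V) : rnorm (x + y) <= rnorm x + rnorm y.
Proof. by rewrite /rnorm -ReKD; apply/le_ReK/ler_normD. Qed.

Lemma rnormN (V : normedModType K) (x : V) : rnorm (- x) = rnorm x.
Proof. by rewrite /rnorm normrN. Qed.

Lemma rnormZ (V : normedModType K) (c : K) (x : V) :
  rnorm (c *: x) = rnorm c * rnorm x.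
Proof.
by rewrite /rnorm normrZ -[ `|c|]ofR_ReK ?ReK_ofRM ?[in RHS]ofR_ReK.
Qed.

Lemma rnormM (c d : K) : rnorm (c * d) = rnorm c * rnorm d.
Proof. exact: (@rnormZ K^o). Qed.

End Norms.

Section InnerProduct.
Variables (R : realType) (k : scalars) (X : hilbertSpace R k).
Notation K := (scalarField R k).
Local Notation "''[' x , y ]" := (inner X x y) : ring_scope.
Implicit Types (x y z : X) (c : K).

Lemma innerC x y : '[x, y] = conjK '[y, x].
Proof. by rewrite [LHS]hermitian_subproof expr0 mul1r. Qed.

Lemma innerDl x y z : '[x + y, z] = '[x, z] + '[y, z].
Proof. exact: linearDl. Qed.

Lemma innerDr x y z : '[z, x + y] = '[z, x] + '[z, y].
Proof. exact: linearDr. Qed.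

Lemma innerZl c x y : '[c *: x, y] = c * '[x, y].
Proof. exact: linearZl_LR. Qed.

Lemma innerZr c x y : '[x, c *: y] = conjK c * '[x, y].
Proof. exact: linearZr_LR. Qed.

Lemma inner_suml (I : Type) (s : seq I) (F : I -> X) y :
  '[\sum_(i <- s) F i, y] = \sum_(i <- s) '[F i, y].
Proof. exact: linear_sumlz. Qed.

Lemma inner_sumr (I : Type) (s : seq I) (F : I -> X) y :
  '[y, \sum_(i <- s) F i] = \sum_(i <- s) '[y, F i].
Proof. exact: linear_sumr. Qed.

Lemma rnorm_innerC x y : rnorm '[x, y] = rnorm '[y, x].
Proof. by rewrite innerC /rnorm norm_conjK. Qed.

Lemma ReK_innerC x y : ReK '[x, y] = ReK '[y, x].
Proof. by rewrite innerC ReK_conj. Qed.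

Lemma ReK_inner x : ReK '[x, x] = rnorm x ^+ 2.
Proof. by rewrite inner_norm expr2 -rnormE ReK_ofRM rnormE expr2. Qed.

Lemma rnorm_sqrD x y :
  rnorm (x + y) ^+ 2 = rnorm x ^+ 2 + rnorm y ^+ 2 + 2 * ReK '[x, y].
Proof.
rewrite -!ReK_inner innerDl !innerDr !ReKD (ReK_innerC y x); lra.
Qed.

Lemma ReK_mul_conj c : ReK (c * conjK c) = rnorm c ^+ 2.
Proof. by rewrite mul_conjK expr2 -[ `|c|]rnormE ReK_ofRM rnormE expr2. Qed.

End InnerProduct.

(** * Orthogonal splitting along one vector *)

Section Pythagoras.
Variables (R : realType) (k : scalars) (X : hilbertSpace R k).
Notation K := (scalarField R k).
Local Notation "''[' x , y ]" := (inner X x y) : ring_scope.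

Lemma pythagoras (x y : X) : '[x, y] = 0 ->
  rnorm (x + y) ^+ 2 = rnorm x ^+ 2 + rnorm y ^+ 2.
Proof. by move=> xy0; rewrite rnorm_sqrD xy0 ReK0 mulr0 addr0. Qed.

(* For [w0 = 0] the coefficient is [0], since [x / 0 = 0]. *)
Definition proj_coef (w0 w : X) : K := '[w, w0] / '[w0, w0].

Definition proj_rest (w0 w : X) : X := w - proj_coef w0 w *: w0.

Lemma proj_rest_orth (w0 w : X) : '[w0, proj_rest w0 w] = 0.
Proof.
suff: '[proj_rest w0 w, w0] = 0.
  by move=> h; rewrite innerC h conjK0.
rewrite /proj_rest -scaleNr innerDl innerZl mulNr /proj_coef.
have [->|w0n0] := eqVneq w0 0.
  have i0 u : '[u, 0] = 0.
    by rewrite -(scale0r (0 : X)) innerZr conjK0 mul0r.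
  by rewrite !i0 mulr0 subr0.
by rewrite divfK ?subrr// inner_norm expf_neq0// normr_eq0.
Qed.

Lemma proj_rest_self (w0 : X) : proj_rest w0 w0 = 0.
Proof.
rewrite /proj_rest /proj_coef; have [->|w0n0] := eqVneq w0 0.
  by rewrite scaler0 subrr.
by rewrite divff ?scale1r ?subrr// inner_norm expf_neq0// normr_eq0.
Qed.

Lemma proj_rest0 (w0 : X) : proj_rest w0 0 = 0.
Proof.
have i0 : '[0, w0] = 0 by rewrite -(scale0r (0 : X)) innerZl mul0r.
by rewrite /proj_rest /proj_coef i0 mul0r scale0r subrr.
Qed.

Lemma proj_decomp (w0 w : X) : w = proj_coef w0 w *: w0 + proj_rest w0 w.
Proof. by rewrite addrC subrK. Qed.

Lemma rnorm_proj (w0 w : X) :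
  rnorm w ^+ 2 =
  rnorm (proj_coef w0 w) ^+ 2 * rnorm w0 ^+ 2 + rnorm (proj_rest w0 w) ^+ 2.
Proof.
rewrite {1}(proj_decomp w0 w) pythagoras ?rnormZ ?exprMn//.
by rewrite innerZl proj_rest_orth mulr0.
Qed.

End Pythagoras.

(** * Duality between Bessel and synthesis bounds *)

Section FrameBounds.
Variables (R : realType) (k : scalars) (I : eqType) (X : hilbertSpace R k).
Notation K := (scalarField R k).
Local Notation "''[' x , y ]" := (inner X x y) : ring_scope.

(** [B] bounds the squared norm of the synthesis operator on finitely supported coefficients, so no
    convergence is involved. Without [uniq], a repeated index would count quadratically on the left
    and linearly on the right. *)
Definition synthesis_bound (F : I -> X) (B : R) :=
  forall (s : seq I) (c : I -> K), uniq s ->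
    rnorm (\sum_(i <- s) c i *: F i) ^+ 2 <= B * \sum_(i <- s) rnorm (c i) ^+ 2.

(** Expand |v|^2 as the sum of Re (c_i <F_i, v>) and apply AM-GM termwise; the Bessel inequality at
    v bounds the second half by |v|^2, which is absorbed on the left. Only finite combinations v of
    the F_i are tested, so a Bessel inequality on a dense subspace containing the F_i is enough. *)
Lemma synthesis_of_analysis (F : I -> X) (B : R) : 0 < B ->
  (forall (s : seq I) (c : I -> K), uniq s ->
     let v := \sum_(i <- s) c i *: F i in
     \sum_(i <- s) rnorm '[v, F i] ^+ 2 <= B * rnorm v ^+ 2) ->
  synthesis_bound F B.
Proof.
move=> B0 bessel s c us; have := bessel s c us.
set v := \sum_(i <- s) c i *: F i => /= bv.
(* AM-GM: [2 |c| |w| <= B |c|^2 + |w|^2 / B] *)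
have amgm i : 2 * ReK (c i * '[F i, v]) <=
    B * rnorm (c i) ^+ 2 + B^-1 * rnorm '[v, F i] ^+ 2.
  have := ReK_le_norm (c i * '[F i, v]); rewrite -/(rnorm _) rnormM.
  rewrite (rnorm_innerC (F i)).
  have BV : B * B^-1 = 1 by rewrite divff ?gt_eqF.
  have := mulr_ge0 (ltW B0) (sqr_ge0 (rnorm (c i) - B^-1 * rnorm '[v, F i])).
  set p := rnorm (c i); set q := rnorm '[v, F i]; set t := ReK _.
  have -> : B * (p - B^-1 * q) ^+ 2 =
      B * p ^+ 2 - 2 * (B * B^-1) * (p * q) + (B * B^-1) * (B^-1 * q ^+ 2) by ring.
  rewrite BV; lra.
have e : rnorm v ^+ 2 = \sum_(i <- s) ReK (c i * '[F i, v]).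
  rewrite -ReK_inner {1}/v inner_suml (big_morph _ (@ReKD R k) (@ReK0 R k)).
  by apply: eq_bigr => i _; rewrite innerZl.
have : 2 * rnorm v ^+ 2 <= B * \sum_(i <- s) rnorm (c i) ^+ 2 +
    B^-1 * \sum_(i <- s) rnorm '[v, F i] ^+ 2.
  by rewrite e !mulr_sumr -big_split /=; apply: ler_sum => i _.
have : B^-1 * \sum_(i <- s) rnorm '[v, F i] ^+ 2 <= rnorm v ^+ 2.
  by rewrite mulrC ler_pdivrMr// mulrC.
lra.
Qed.

Lemma analysis_of_synthesis (F : I -> X) (B : R) (s : seq I) (z : X) :
  0 < B -> synthesis_bound F B -> uniq s ->
  \sum_(i <- s) rnorm '[z, F i] ^+ 2 <= B * rnorm z ^+ 2.
Proof.
(* The coefficients <z, F_i> make <z, v> equal to the sum S to be bounded, while the synthesis bound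
   gives |v|^2 <= B S. *)
move=> B0 FB us; have := FB s (fun i => '[z, F i]) us.
set v := \sum_(i <- s) _; set S := \sum_(i <- s) _ => vS.
have zv : ReK '[z, v] = S.
  rewrite ReK_innerC inner_suml (big_morph _ (@ReKD R k) (@ReK0 R k)).
  by apply: eq_bigr => i _; rewrite innerZl (innerC (F i)) ReK_mul_conj.
(* Expanding |z - t v|^2 >= 0 gives 0 <= |z|^2 - 2 t S + t^2 B S; t = 1/B minimises the right-hand
   side, which becomes |z|^2 - S / B. *)
have := sqr_ge0 (rnorm (z + ofR k (- B^-1) *: v)).
rewrite rnorm_sqrD innerZr conj_ofR ReK_ofRM zv rnormZ exprMn.
rewrite -[rnorm (ofR k _) ^+ 2]ReK_mul_conj conj_ofR ReK_ofRM ReK_ofR => h.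
have h2 : B^-1 * (B^-1 * rnorm v ^+ 2) <= B^-1 * S.
  by rewrite ler_pM2l ?invr_gt0// mulrC ler_pdivrMr// mulrC.
rewrite -ler_pdivrMl//; nra.
Qed.

End FrameBounds.

(** * Synthesis bounds in the tensor product *)

Section TensorFrameBounds.
Variables (R : realType) (k : scalars) (X Y : hilbertSpace R k).
Variables (T : hilbertTensor X Y).
Notation K := (scalarField R k).

Lemma tensDl (x x' : X) (y : Y) : tens T (x + x') y = tens T x y + tens T x' y.
Proof. exact: linearDl. Qed.

Lemma tensDr (x : X) (y y' : Y) : tens T x (y + y') = tens T x y + tens T x y'.
Proof. exact: linearDr. Qed.

Lemma tensZl (c : K) (x : X) (y : Y) : tens T (c *: x) y = c *: tens T x y.
Proof. exact: linearZl_LR. Qed.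

Lemma tensZr (c : K) (x : X) (y : Y) : tens T x (c *: y) = c *: tens T x y.
Proof. exact: linearZr_LR. Qed.

Lemma tens_suml (I : Type) (s : seq I) (F : I -> X) (y : Y) :
  tens T (\sum_(i <- s) F i) y = \sum_(i <- s) tens T (F i) y.
Proof. exact: linear_sumlz. Qed.

Lemma tens_sumr (I : Type) (s : seq I) (F : I -> Y) (x : X) :
  tens T x (\sum_(i <- s) F i) = \sum_(i <- s) tens T x (F i).
Proof. exact: linear_sumr. Qed.

Lemma rnorm_tens (x : X) (y : Y) : rnorm (tens T x y) = rnorm x * rnorm y.
Proof.
apply/eqP; rewrite -(@eqrXn2 _ 2)// ?mulr_ge0 ?rnorm_ge0// exprMn.
rewrite -(ReK_inner (tens T x y)) tens_inner inner_norm expr2 -rnormE -mulrA.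
by rewrite !ReK_ofRM ReK_inner mulrA.
Qed.

(* Splitting every [w i] along one of them, [w0], splits the sum orthogonally
   into [(\sum_i u i F i) (x) w0] and a sum with one more vanishing term. *)
Lemma synthesis_tensl (I : eqType) (F : I -> X) (B : R) (s : seq I) (w : I -> Y) :
  synthesis_bound F B -> uniq s ->
  rnorm (\sum_(i <- s) tens T (F i) (w i)) ^+ 2 <=
    B * \sum_(i <- s) rnorm (w i) ^+ 2.
Proof.
move=> FB us.
(* Induction on a list [t] containing every index of [s] where [w] is nonzero, starting from
   [t = s]. The family [w] stays general because each step replaces it by [w']. *)
suff {w} h (t : seq I) (w : I -> Y) : (forall i, i \notin t -> i \in s -> w i = 0) ->
    rnorm (\sum_(i <- s) tens T (F i) (w i)) ^+ 2 <=
      B * \sum_(i <- s) rnorm (w i) ^+ 2.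
  by apply: (h s) => i /negPf->.
elim: t w => [|i0 t IH] w w0.
  rewrite big_seq big1 => [|i si]; last by rewrite w0// linear0r.
  rewrite big_seq big1 => [|i si]; last by rewrite w0// /rnorm normr0 ReK0 expr0n.
  by rewrite /rnorm normr0 ReK0 expr0n mulr0.
pose u i := proj_coef (w i0) (w i); pose w' i := proj_rest (w i0) (w i).
have -> : \sum_(i <- s) tens T (F i) (w i) =
    tens T (\sum_(i <- s) u i *: F i) (w i0) + \sum_(i <- s) tens T (F i) (w' i).
  rewrite tens_suml -big_split /=; apply: eq_bigr => i _.
  by rewrite tensZl -tensZr -tensDr -proj_decomp.
rewrite pythagoras; last first.
  by rewrite inner_sumr big1// => i _; rewrite tens_inner proj_rest_orth mulr0.
have -> : \sum_(i <- s) rnorm (w i) ^+ 2 =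
    (\sum_(i <- s) rnorm (u i) ^+ 2) * rnorm (w i0) ^+ 2 +
    \sum_(i <- s) rnorm (w' i) ^+ 2.
  rewrite mulr_suml -big_split /=; apply: eq_bigr => i _; exact: rnorm_proj.
(* The first part has the scalar coefficients [u], so the bound for [F] applies to it directly; the
   second falls under the induction hypothesis, since [w'] vanishes at [i0] and wherever [w]
   does. *)
rewrite mulrDr lerD//.
  by rewrite rnorm_tens exprMn mulrA ler_wpM2r ?sqr_ge0 ?FB.
apply: IH => i it si; rewrite /w'; have [->|ii0] := eqVneq i i0.
  exact: proj_rest_self.
by rewrite (w0 i) ?proj_rest0// inE negb_or ii0.
Qed.

End TensorFrameBounds.

(** Extension by zero to a rectangle, so that an arbitrary finite set of pairs can be summed row by
    row. *)
Lemma big_pair_mem (V : nmodType) (I J : eqType) (s : seq (I * J)) (s1 : seq I)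
    (s2 : seq J) (h : I * J -> V) :
  uniq s -> uniq s1 -> uniq s2 ->
  {subset s <= [seq (i, j) | i <- s1, j <- s2]} ->
  \sum_(p <- s) h p =
  \sum_(i <- s1) \sum_(j <- s2) if (i, j) \in s then h (i, j) else 0.
Proof.
move=> us us1 us2 sub.
transitivity (\sum_(p <- [seq (i, j) | i <- s1, j <- s2])
    if p \in s then h p else 0); last by rewrite big_allpairs.
rewrite -big_mkcond -big_filter.
apply: perm_big; apply: uniq_perm => //.
  by rewrite filter_uniq// allpairs_uniq// => -[? ?] [? ?] _ _ [-> ->].
by move=> p; rewrite mem_filter; case: (boolP (p \in s)) => //= /sub ->.
Qed.

Lemma sub_allpairs (I J : eqType) (s : seq (I * J)) :
  {subset s <= [seq (i, j) | i <- undup (map fst s), j <- undup (map snd s)]}.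
Proof.
move=> [i j] ps; apply/allpairsP; exists (i, j); split=> //=;
  by rewrite mem_undup; [apply: (map_f fst ps) || apply: (map_f snd ps)].
Qed.

(** Grouping by rows gives the sum of F_i (x) w_i with w_i = sum_j e_ij G_j. The one-sided bound
    yields the factor [B], and the bound for [G] in each row yields [C]. *)
Lemma synthesis_tens (R : realType) (k : scalars) (X Y : hilbertSpace R k)
    (T : hilbertTensor X Y) (I J : eqType) (F : I -> X) (G : J -> Y) (B C : R) :
  0 <= B -> synthesis_bound F B -> synthesis_bound G C ->
  synthesis_bound (fun p : I * J => tens T (F p.1) (G p.2)) (B * C).
Proof.
move=> B0 FB GC s e us.
set s1 := undup (map fst s); set s2 := undup (map snd s).
pose e' i j := if (i, j) \in s then e (i, j) else 0.
rewrite !(@big_pair_mem _ _ _ s s1 s2) ?undup_uniq//; try exact: sub_allpairs.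
have -> : \sum_(i <- s1) \sum_(j <- s2)
    (if (i, j) \in s then e (i, j) *: tens T (F i) (G j) else 0) =
    \sum_(i <- s1) tens T (F i) (\sum_(j <- s2) e' i j *: G j).
  apply: eq_bigr => i _; rewrite tens_sumr; apply: eq_bigr => j _.
  by rewrite tensZr /e'; case: ifP => // _; rewrite scale0r.
apply: le_trans (synthesis_tensl _ _ FB (undup_uniq _)) _.
rewrite -mulrA ler_wpM2l// mulr_sumr; apply: ler_sum => i _.
apply: le_trans (GC _ _ (undup_uniq _)) _.
rewrite le_eqVlt; apply/orP; left; apply/eqP; congr (_ * _).
apply: eq_bigr => j _; rewrite /e'; case: ifP => // _.
by rewrite /rnorm normr0 ReK0 expr0n.
Qed.

(** Radii are positive elements of the scalar field, hence real, and translate to [R]. The filter is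
    arbitrary so as to cover both [\oo] and [totally]. *)
Lemma cvg_rnormP (R : realType) (k : scalars) (V : normedModType (scalarField R k))
    (I : Type) (F : set_system I) (FF : Filter F) (u : I -> V) (x : V) :
  u @ F --> x <->
  forall e : R, 0 < e -> \forall t \near F, rnorm (x - u t) < e.
Proof.
rewrite cvgrPdist_lt; split=> h e e0.
  have ke : 0 < ofR k e by rewrite -(ofR0 R k) ltr_ofR.
  by apply: filterS (h _ ke) => t; rewrite -rnormE ltr_ofR.
apply: filterS (h _ (ReK_gt0 e0)) => t.
by rewrite -(ltr_ofR k) rnormE ofR_ReK ?ltW.
Qed.

(** * Unordered sums of nonnegative reals *)

Section Sums.
Variable R : realType.

(** [\esum] is a supremum over finite sets, and these are enumerated by duplicate-free lists. *)
Lemma esum_leP (I : choiceType) (a : I -> R) (M : R) :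
  (\esum_(i in [set: I]) (a i)%:E <= M%:E)%E <->
  forall s : seq I, uniq s -> \sum_(i <- s) a i <= M.
Proof.
split=> [h s us|h].
  rewrite -lee_fin -sumEFin; apply: le_trans h; apply: ereal_sup_ubound.
  exists [set` s]; last by rewrite -fsbig_seq.
  by split=> //; exact: finite_seq.
apply: ge_ereal_sup => _ [A [finA _] <-].
by rewrite fsbig_finite//= sumEFin lee_fin h.
Qed.

Lemma poweR12_le (x : \bar R) (M : R) : (0 <= x)%E -> 0 <= M ->
  (x `^ 2^-1 <= M%:E)%E = (x <= (M ^+ 2)%:E)%E.
Proof.
move=> x0 M0; case: x x0 => [r| |] //.
- rewrite poweR_EFin !lee_fin => r0; rewrite powR12_sqrt//.
  by rewrite -[RHS](ler_sqrt r) ?sqr_ge0// sqrtr_sqr ger0_norm.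
- by rewrite poweRyr// invr_eq0 pnatr_eq0.
Qed.

Lemma l2norm_leP (k : scalars) (I : choiceType) (c : I -> scalarField R k) (M : R) :
  0 <= M -> (l2norm c <= M%:E)%E <->
  forall s : seq I, uniq s -> \sum_(i <- s) rnorm (c i) ^+ 2 <= M ^+ 2.
Proof.
move=> M0; rewrite /l2norm poweR12_le//; first exact: esum_leP.
by apply: esum_ge0 => i _; rewrite lee_fin sqr_ge0.
Qed.

Lemma sum_pair_le (I J : eqType) (a : I -> R) (b : J -> R) (s : seq (I * J))
    (s1 : seq I) (s2 : seq J) :
  (forall i, 0 <= a i) -> (forall j, 0 <= b j) ->
  uniq s -> uniq s1 -> uniq s2 ->
  {subset s <= [seq (i, j) | i <- s1, j <- s2]} ->
  \sum_(p <- s) a p.1 * b p.2 <= (\sum_(i <- s1) a i) * \sum_(j <- s2) b j.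
Proof.
move=> a0 b0 us us1 us2 sub; rewrite (@big_pair_mem _ _ _ s s1 s2)// mulr_suml.
apply: ler_sum => i _; rewrite mulr_sumr; apply: ler_sum => j _ /=.
by case: ifP => // _; exact: mulr_ge0.
Qed.

Lemma sum_pair_bounded (I J : eqType) (a : I -> R) (b : J -> R) (A B : R)
    (s : seq (I * J)) :
  (forall i, 0 <= a i) -> (forall j, 0 <= b j) ->
  (forall t, uniq t -> \sum_(i <- t) a i <= A) ->
  (forall t, uniq t -> \sum_(i <- t) b i <= B) ->
  uniq s -> \sum_(p <- s) a p.1 * b p.2 <= A * B.
Proof.
move=> a0 b0 aA bB us.
apply: le_trans (sum_pair_le a0 b0 us (undup_uniq _) (undup_uniq _) _) _.
  exact: sub_allpairs.
by apply: ler_pM; rewrite ?sumr_ge0 ?aA ?bB ?undup_uniq.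
Qed.

(** The square sums [P N] increase to a limit. A finite set outside [0, N)^2, joined with that
    square, fits in some [0, M)^2, so its sum is at most P M - P N, which is below the distance from
    [P N] to the limit. *)
Lemma sum_pair_tail (a b : nat -> R) (A B : R) :
  (forall i, 0 <= a i) -> (forall j, 0 <= b j) ->
  (forall t, uniq t -> \sum_(i <- t) a i <= A) ->
  (forall t, uniq t -> \sum_(i <- t) b i <= B) ->
  forall e, 0 < e -> \forall N \near \oo, forall s : seq (nat * nat), uniq s ->
    (forall p, p \in s -> ~~ ((p.1 < N) && (p.2 < N))%N) ->
    \sum_(p <- s) a p.1 * b p.2 <= e.
Proof.
move=> a0 b0 aA bB e e0.
pose P N := (\sum_(0 <= i < N) a i) * (\sum_(0 <= j < N) b j).
have ndsum (u : nat -> R) : (forall i, 0 <= u i) ->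
    nondecreasing_seq (fun N => \sum_(0 <= i < N) u i).
  move=> u0; apply/nondecreasing_seqP => N.
  by rewrite big_nat_recr//= lerDl.
have ndP : nondecreasing_seq P.
  by move=> N M NM; apply: ler_pM; rewrite ?sumr_ge0// ndsum.
have cP : cvgn P.
  apply: nondecreasing_is_cvgn => //; exists (A * B) => _ [N _ <-].
  by apply: ler_pM; rewrite ?sumr_ge0// ?aA ?bB// iota_uniq.
have : \forall N \near \oo, `|limn P - P N| < e by exact: (cvgrPdist_lt _ _).1.
apply: filterS => N; rewrite ger0_norm ?subr_ge0; last first.
  exact: nondecreasing_cvgn_le.
move=> PN s us sN.
pose Q := [seq (i, j) | i <- index_iota 0 N, j <- index_iota 0 N].
(* A crude bound that is at least [N] and exceeds every coordinate occurring in [s]. *)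
pose M := (N + \sum_(p <- s) (p.1 + p.2).+1)%N.
have PE : P N = \sum_(p <- Q) a p.1 * b p.2.
  rewrite /Q big_allpairs /P mulr_suml; apply: eq_bigr => i _.
  by rewrite mulr_sumr.
have uQ : uniq Q by rewrite allpairs_uniq ?iota_uniq// => -[? ?] [? ?] _ _ [-> ->].
have : \sum_(p <- s ++ Q) a p.1 * b p.2 <= P M.
  apply: sum_pair_le; rewrite ?iota_uniq//.
    rewrite cat_uniq us uQ andbT /=; apply/hasPn => p.
    case/allpairsP => -[i j] /= []; rewrite !mem_index_iota /= => iN jN ->.
    by apply/negP => /sN /=; rewrite iN jN.
  move=> [i j]; rewrite mem_cat => h; apply/allpairsP; exists (i, j).
  rewrite !mem_index_iota /=.
  case/orP: h => [ps|/allpairsP[[i' j'] /= []]].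
    have : ((i + j).+1 <= M)%N.
      by rewrite /M (big_rem _ ps) /= addnCA leq_addr.
    by move=> h; split=> //; apply: leq_trans h; rewrite ltnS ?leq_addr ?leq_addl.
  rewrite !mem_index_iota /= => iN jN [-> ->].
  by split=> //; [apply: leq_trans iN _|apply: leq_trans jN _]; exact: leq_addr.
rewrite big_cat /= -PE => h.
have := nondecreasing_cvgn_le ndP cP M; lra.
Qed.

End Sums.

(** * Convergence of tensor series *)

Section TensorConvergence.
Variables (R : realType) (k : scalars) (X Y : hilbertSpace R k).
Variables (T : hilbertTensor X Y).
Notation K := (scalarField R k).

Lemma cvg_tens (I : Type) (F : set_system I) (FF : Filter F) (u : I -> X)
    (v : I -> Y) (x : X) (y : Y) :
  u @ F --> x -> v @ F --> y -> (fun i => tens T (u i) (v i)) @ F --> tens T x y.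
Proof.
move=> /cvg_rnormP ux /cvg_rnormP vy; apply/cvg_rnormP => e e0.
have y0 := rnorm_ge0 y; have x0 := rnorm_ge0 x.
(* Adding 1 keeps the denominators positive for zero vectors. In the second one it also makes |x| +
   1 a bound for |u i| once |x - u i| < 1. *)
have e1 : 0 < e / 2 / (rnorm y + 1) by rewrite !divr_gt0// ltr_wpDl.
have e2 : 0 < e / 2 / (rnorm x + 1) by rewrite !divr_gt0// ltr_wpDl.
apply: filterS3 (ux _ ltr01) (ux _ e1) (vy _ e2) => i.
rewrite !ltr_pdivlMr ?ltr_wpDl// => h1 h2 h3.
have -> : tens T x y - tens T (u i) (v i) =
    tens T (x - u i) y + tens T (u i) (y - v i).
  by rewrite -!(scaleN1r (u i)) -(scaleN1r (v i)) tensDl tensDr tensZl tensZr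
    !scaleN1r addrA subrK.
apply: le_lt_trans (rnormD _ _) _; rewrite !rnorm_tens.
have hu : rnorm (u i) <= rnorm x + 1.
  rewrite -[u i](subrK x) addrC; apply: le_trans (rnormD _ _) _.
  by rewrite lerD2l -rnormN opprB ltW.
have := rnorm_ge0 (x - u i); have := rnorm_ge0 (y - v i).
have := ler_wpM2r (rnorm_ge0 (y - v i)) hu; nra.
Qed.

Lemma cvg_partial_sum_tens (F : nat -> X) (G : nat -> Y) (B C : R)
    (c d : nat -> K) (M N : R) (x : X) (y : Y) :
  0 < B -> 0 < C -> synthesis_bound F B -> synthesis_bound G C ->
  (forall s, uniq s -> \sum_(i <- s) rnorm (c i) ^+ 2 <= M) ->
  (forall s, uniq s -> \sum_(i <- s) rnorm (d i) ^+ 2 <= N) ->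
  series (fun i => c i *: F i) @ \oo --> x ->
  series (fun i => d i *: G i) @ \oo --> y ->
  partial_sum (fun p => (c p.1 * d p.2) *: tens T (F p.1) (G p.2)) @ totally
    --> tens T x y.
Proof.
move=> B0 C0 FB GC cM dN cx dy.
have BC0 : 0 < B * C by exact: mulr_gt0.
apply/(cvg_rnormP (@totally_filter _)) => e e0.
(* Multiplied by the synthesis bound [B * C], this tail becomes (e / 4)^2. *)
have e40 : 0 < (e / 4) ^+ 2 / (B * C) by rewrite divr_gt0// exprn_gt0// divr_gt0.
have /cvg_rnormP S : (fun n => tens T (series (fun i => c i *: F i) n)
    (series (fun i => d i *: G i) n)) @ \oo --> tens T x y by exact: cvg_tens.
have tail := sum_pair_tail (fun i => sqr_ge0 _) (fun i => sqr_ge0 _) cM dN e40.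
(* One [n] serves twice: the square sum is within e / 2 of the limit, and the coefficients outside
   the square have a small tail. *)
have [n [Sn tailn]] : exists n, rnorm (tens T x y - tens T
    (series (fun i => c i *: F i) n) (series (fun i => d i *: G i) n)) < e / 2 /\
    forall s : seq (nat * nat), uniq s ->
    (forall p, p \in s -> ~~ ((p.1 < n) && (p.2 < n))%N) ->
    \sum_(p <- s) rnorm (c p.1) ^+ 2 * rnorm (d p.2) ^+ 2 <= (e / 4) ^+ 2 / (B * C).
  have e20 : 0 < e / 2 by rewrite divr_gt0.
  by have [n] := @filter_ex _ \oo _ _ (filterI (S _ e20) tail); exists n.
pose Q := [seq (i, j) | i <- index_iota 0 n, j <- index_iota 0 n].
have uQ : uniq Q by rewrite allpairs_uniq ?iota_uniq// => -[? ?] [? ?] _ _ [-> ->].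
exists [fset p in Q]%fset => // A /= QA.
pose h p := (c p.1 * d p.2) *: tens T (F p.1) (G p.2).
have hQ : tens T (series (fun i => c i *: F i) n) (series (fun i => d i *: G i) n) =
    \sum_(p <- Q) h p.
  rewrite /Q big_allpairs /series /= tens_suml; apply: eq_bigr => i _.
  by rewrite tens_sumr; apply: eq_bigr => j _; rewrite tensZl tensZr scalerA.
(* As [A] contains the square [Q], its sum is the square sum plus the sum over [s], which the
   synthesis bound and the tail keep within e / 4. *)
pose s := [seq p <- A | p \notin Q].
have us : uniq s by rewrite filter_uniq ?fset_uniq.
have hA : partial_sum h A = \sum_(p <- Q) h p + \sum_(p <- s) h p.
  rewrite /partial_sum -(big_seq_fsetE _ _ xpredT) /= (bigID (mem Q)) /=.
  rewrite [in RHS]big_filter.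
  congr (_ + _); rewrite -big_filter; apply: perm_big; apply: uniq_perm => //.
    by rewrite filter_uniq ?fset_uniq.
  move=> p; rewrite mem_filter andb_idr// => pQ.
  by apply: (fsubsetP QA); rewrite inE.
have hs : rnorm (\sum_(p <- s) h p) <= e / 4.
  rewrite -ler_sqr ?nnegrE ?rnorm_ge0 ?divr_ge0 ?(ltW e0)//.
  apply: le_trans (synthesis_tens T (ltW B0) FB GC (fun p => c p.1 * d p.2) us) _.
  rewrite mulrC -ler_pdivlMr//.
  under eq_bigr do rewrite rnormM exprMn.
  apply: tailn => // -[i j]; rewrite mem_filter => /andP[+ _].
  apply: contra => /= /andP[ni nj]; apply/allpairsP; exists (i, j).
  by rewrite !mem_index_iota.
rewrite -/h hA opprD addrA -hQ; apply: le_lt_trans (rnormD _ _) _.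
rewrite rnormN; lra.
Qed.

End TensorConvergence.

(** * From atomic systems to their tensor product *)

(** The Bessel inequality is assumed on [H] only, but a finite combination of classes is the class
    of a vector of [H], so it holds where [synthesis_of_analysis] tests it. *)
Lemma bessel_synthesis (R : realType) (k : scalars) (n : nat)
    (H : nInnerSpace R k n) (a : n.-1.-tuple H) (HF : assocHilbert a)
    (f_ : nat -> H) :
  is_bessel a f_ ->
  exists2 B : R, 0 < B & synthesis_bound (fun i => to_compl HF (f_ i)) B.
Proof.
move=> [B B0 bessel]; exists B => //; apply: synthesis_of_analysis => // s c us.
have -> : \sum_(i <- s) c i *: to_compl HF (f_ i) =
    to_compl HF (\sum_(i <- s) c i *: f_ i).
  by rewrite linear_sum; apply: eq_bigr => i _; rewrite linearZ.
move: (\sum_(i <- s) _) => v /=.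
have := bessel v; rewrite nneseries_esum => [|i _]; last first.
  by rewrite lee_fin sqr_ge0.
rewrite set_true => /esum_leP /(_ s us).
rewrite /nnorm -(to_compl_inner HF) ReK_inner sqrtr_sqr ger0_norm ?rnorm_ge0//.
by under [in X in _ -> X]eq_bigr do rewrite to_compl_inner.
Qed.

Theorem theorem4p7 (R : realType) (k : scalars) (n : nat) (n_gt0 : (0 < n)%N)
    (H1 H2 : nInnerSpace R k n)
    (H1_nHilbert : is_nHilbert H1) (H2_nHilbert : is_nHilbert H2)
    (a : n.-1.-tuple H1) (b : n.-1.-tuple H2)
    (a_indep : lin_indep a) (b_indep : lin_indep b)
    (HF : assocHilbert a) (KG : assocHilbert b) (T : hilbertTensor HF KG)
    (K1 : {linear HF -> HF}) (K2 : {linear KG -> KG}) (K12 : {linear T -> T})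
    (K1_bounded : bounded_operator K1) (K2_bounded : bounded_operator K2)
    (K12_tensor : is_tensor_operator K1 K2 K12)
    (f_ : nat -> H1) (g_ : nat -> H2)
    (f_atomic : is_atomic_system K1 f_) (g_atomic : is_atomic_system K2 g_) :
  is_tensor_atomic_system K12 f_ g_.
Proof.
have [f_bessel [C C0 f_sum]] := f_atomic.
have [g_bessel [D D0 g_sum]] := g_atomic.
have [B1 B10 f_synth] := bessel_synthesis HF f_bessel.
have [B2 B20 g_synth] := bessel_synthesis KG g_bessel.
split.
  exists (B1 * B2) => [|f g]; first exact: mulr_gt0.
  apply/esum_leP => s us.
  have fg_synth := synthesis_tens T (ltW B10) f_synth g_synth.
  apply: (analysis_of_synthesis _ _ fg_synth) => //.
  exact: mulr_gt0.
(* The constants multiply because |f (x) g| = |f| |g|; the coefficients are those of f and g taken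
   separately. *)
exists (C * D) => [|f g]; first exact: mulr_gt0.
have [c [c_lty c_cvg c_le]] := f_sum f; have [d [d_lty d_cvg d_le]] := g_sum g.
have Cf0 : 0 <= C * rnorm f by rewrite mulr_ge0 ?rnorm_ge0// ltW.
have Dg0 : 0 <= D * rnorm g by rewrite mulr_ge0 ?rnorm_ge0// ltW.
move: c_le d_le => /(l2norm_leP _ Cf0) c_le /(l2norm_leP _ Dg0) d_le.
exists c, d => cd; split=> //.
  rewrite (K12_tensor.2 f g).
  exact: (cvg_partial_sum_tens B10 B20 f_synth g_synth c_le d_le).
rewrite rnorm_tens mulrACA; apply/l2norm_leP; first exact: mulr_ge0.
move=> s us; under eq_bigr do rewrite rnormM exprMn.
rewrite exprMn.
by apply: (sum_pair_bounded _ _ c_le d_le us) => i; exact: sqr_ge0.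
Qed.
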